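(* Let $X$ be a second countable complex topological vector space and let $\Gamma\subset\mathcal{B}(X)$. If $\Gamma$ is diskcyclic, then $$\mathbb{D}C(\Gamma)=\bigcap_{n\ge1}\Big(\bigcup_{T\in\Gamma}\ \bigcup_{\beta\in\mathbb{U}}T^{-1}(\beta U_n)\Big),$$ where $(U_n)_{n\ge1}$ is a countable basis of the topology of $X$ consisting of nonempty open sets and $\mathbb{U}=\{\beta\in\mathbb{C}:|\beta|\ge1\}$. As a consequence, $\mathbb{D}C(\Gamma)$ is a $G_\delta$ set.
   Context: $\mathcal{B}(X)$ is the set of all continuous linear operators on $X$, and $\mathbb{D}=\{\alpha\in\mathbb{C}:|\alpha|\le 1\}$. A vector $x\in X$ is a diskcyclic vector for $\Gamma$ if $\{\alpha Tx:\alpha\in\mathbb{D},\,T\in\Gamma\}$ is dense in $X$; $\mathbb{D}C(\Gamma)$ is the set of all diskcyclic vectors for $\Gamma$, and $\Gamma$ is diskcyclic if $\mathbb{D}C(\Gamma)\neq\emptyset$. $T^{-1}(\cdot)$ denotes preimage. *)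

(* Defs.v *)
From HB Require Import structures.
From mathcomp Require Import all_boot all_order all_algebra.
From mathcomp Require Import all_classical all_reals all_analysis.
From mathcomp Require Import borel_hierarchy complex.

Set Implicit Arguments.
Unset Strict Implicit.
Unset Printing Implicit Defensive.

Import Order.TTheory GRing.Theory Num.Theory.
Local Open Scope classical_set_scope.
Local Open Scope ring_scope.
Local Open Scope complex_scope.

Section Diskcyclic.
Context (R : realType).

(* The norm of R[i] takes its values in R[i]; `|a| <= 1 and 1 <= `|a| compare
   elements of R[i], and the modulus of a is always real. *)
Definition closed_unit_disk : set R[i] := [set a | `|a| <= 1].

Definition unit_disk_exterior : set R[i] := [set b | 1 <= `|b|].

(* topologicalLmodType is a topological vector space (jointly continuous
   addition and scaling), with no local convexity or separation axiom. *)
Variable X : topologicalLmodType R[i].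

Definition continuous_operators : set {linear X -> X} :=
  [set T | continuous T].

Definition disk_orbit (Gamma : set {linear X -> X}) (x : X) : set X :=
  [set y | exists a : R[i], exists T : {linear X -> X},
    [/\ closed_unit_disk a, Gamma T & y = a *: T x]].

Definition diskcyclic_vectors (Gamma : set {linear X -> X}) : set X :=
  [set x | dense (disk_orbit Gamma x)].

Definition diskcyclic (Gamma : set {linear X -> X}) : Prop :=
  diskcyclic_vectors Gamma !=set0.

End Diskcyclic.

(* Main.v *)
Require Import Defs.
From HB Require Import structures.
From mathcomp Require Import all_boot all_order all_algebra.
From mathcomp Require Import all_classical all_reals all_analysis.
From mathcomp Require Import borel_hierarchy complex.

Import Order.TTheory GRing.Theory Num.Theory.
Local Open Scope classical_set_scope.
Local Open Scope ring_scope.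
Local Open Scope complex_scope.

(** For [c != 0], the point [c *: T x] lies in [U n] exactly when [T x] lies in [c^-1 *: U n], and
    inversion exchanges the nonzero scalars of the closed disk with the exterior. Density only has
    to be tested on a basis, so the formula follows once the scalar 0 is dealt with, which is the
    role of [small_scalar]. Each set in the intersection is open: scaling by [b != 0] is a
    homeomorphism ([open_scale]) and each [T] in [Gamma] is continuous. A countable basis indexed by
    [nat] ([second_countable_basis_seq]) then gives the G-delta property. *)

Lemma scale_continuousr (K : numDomainType) (X : topologicalLmodType K) (a : K) :
  continuous (fun x : X => a *: x).
Proof.
move=> x; apply: (@continuous2_cvg X K^o X X (nbhs x) _ (fun=> a) id
  (fun (a : K^o) (x : X) => a *: x) a x).
- exact: (scale_continuous (a, x)).
- exact: cvg_cst.
- exact: cvg_id.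
Qed.

Lemma scale_continuousl (K : numDomainType) (X : topologicalLmodType K) (x : X) :
  continuous (fun a : K^o => a *: x).
Proof.
move=> a; apply: (@continuous2_cvg K^o K^o X X (nbhs a) _ id (fun=> x)
  (fun (a : K^o) (x : X) => a *: x) a x).
- exact: (scale_continuous (a, x)).
- exact: cvg_id.
- exact: cvg_cst.
Qed.

Lemma open_scale (K : numFieldType) (X : topologicalLmodType K) (b : K)
    (U : set X) :
  b != 0 -> open U -> open [set b *: u | u in U].
Proof.
move=> b0 oU; suff -> : [set b *: u | u in U] = (fun x => b^-1 *: x) @^-1` U.
  by apply: open_comp => // x _; exact: scale_continuousr.
apply/seteqP; split=> [_ [u Uu <-]|x Ux] /=; first by rewrite scalerK.
by exists (b^-1 *: x); rewrite ?scalerKV.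
Qed.

(** The map [a |-> a *: x] is continuous and sends 0 to 0, so every scalar close enough to 0 works,
    and nonzero ones exist arbitrarily close to 0. *)
Lemma small_scalar (K : numFieldType) (X : topologicalLmodType K) (x : X)
    (U : set X) :
  nbhs 0 U -> exists a : K, [/\ a != 0, `|a| <= 1 & U (a *: x)].
Proof.
move=> U0.
have nU : \forall a \near (0 : K^o), U (a *: x).
  by apply: (scale_continuousl _ _ x 0 U); rewrite scale0r.
have n1 : \forall a \near (0 : K^o), `|a| <= 1.
  by apply: filterS (nbhs0_lt (V := K^o) ltr01) => a; exact: ltW.
(* The punctured neighbourhoods of 0 form a proper filter, which yields an actual nonzero scalar. *)
have /filter_ex[a [a0 [Ua a1]]] :
    \forall a \near (0 : K^o)^', a != 0 /\ U (a *: x) /\ `|a| <= 1.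
  apply: filterI; first exact: (@nbhs_dnbhs_neq K^o).
  by apply: filterI; exact: nbhs_dnbhs.
by exists a.
Qed.

Lemma unit_disk_exterior_neq0 (R : realType) (b : R[i]) :
  unit_disk_exterior b -> b != 0.
Proof. by rewrite /unit_disk_exterior /= -normr_gt0; exact: lt_le_trans. Qed.

Lemma basis_subset (T : topologicalType) (B : set (set T)) (O : set T) (x : T) :
  basis B -> open O -> O x -> exists V, [/\ B V, V x & V `<=` O].
Proof.
move=> [_ Bx] oO Ox; have [V [BV Vx] VO] := Bx x O (open_nbhs_nbhs (conj oO Ox)).
by exists V.
Qed.

(** Discarding the empty set from a countable basis leaves a basis, since a basic set around a point
    is inhabited. The point [x] ensures that something is left to enumerate. *)
Lemma second_countable_basis_seq (T : topologicalType) (x : T) :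
  @second_countable T ->
  exists U : nat -> set T, basis (range U) /\ forall n, U n !=set0.
Proof.
move=> [B cB bB]; have [Bo Bn] := bB.
pose B' := B `&` [set V | V !=set0].
have bB' : basis B'.
  split=> [V [/Bo]//|y O /Bn[V [BV Vy] VO]].
  by exists V => //; split=> //; split=> //; exists y.
have cB' : countable B' by apply: sub_countable cB; apply: subset_card_le => V [].
have [V0 [B'V0 _ _]] := basis_subset _ _ _ _ bB' openT (I : setT x).
(* A countable set is either empty, which [V0] excludes, or the image of a surjection from [nat],
   possibly with repetitions. *)
have /pfcard_geP[B'0|/unsquash U] := cB'; first by rewrite B'0 in B'V0.
exists U; have rU : range U = B'.
  by apply/seteqP; split=> [_ [n _ <-]|V /(@surj _ _ _ _ U)//]; exact: funS.
split=> [|n]; first by rewrite rU.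
by have [] : B' (U n) by exact: funS.
Qed.

Lemma diskcyclic_vectorsE (R : realType) (X : topologicalLmodType R[i])
    (Gamma : set {linear X -> X}) (U : nat -> set X) :
  basis (range U) -> (forall n, U n !=set0) ->
  diskcyclic_vectors Gamma =
  \bigcap_n \bigcup_(T in Gamma) \bigcup_(b in @unit_disk_exterior R)
     ((T : X -> X) @^-1` [set b *: u | u in U n]).
Proof.
move=> bU U0; apply/seteqP; split=> x.
- move=> dx n _.
  have oU : open (U n) by apply: bU.1; exists n.
  have [y [Uy [a [T [a1 GT ya]]]]] := dx _ (U0 n) oU.
  (* If [a = 0] then [U n] is a neighbourhood of 0, and a small nonzero scalar
     does the job instead. *)
  have [c [c0 c1 Uc]] : exists c : R[i], [/\ c != 0, `|c| <= 1 & U n (c *: T x)].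
    have [a0|a0] := eqVneq a 0; last by exists a; rewrite -ya.
    apply: small_scalar; apply: open_nbhs_nbhs; split=> //.
    by move: Uy; rewrite ya a0 scale0r.
  exists T => //; exists c^-1; last by exists (c *: T x); rewrite ?scalerK.
  by rewrite /unit_disk_exterior /= normfV invf_ge1 ?normr_gt0.
- move=> Ux O [y Oy] oO.
  have [_ [[n _ <-] _ UO]] := basis_subset _ _ _ _ bU oO Oy.
  have [T GT [b b1 [u Uu bu]]] := Ux n I.
  have b0 := unit_disk_exterior_neq0 _ _ b1.
  (* Since [T x = b *: u] with [b] nonzero, [u = b^-1 *: T x] is a point of the disk orbit inside
     [U n], hence inside [O]. *)
  exists u; split; first exact: UO.
  exists b^-1, T; split=> //; last by rewrite -bu scalerK.
  by rewrite /closed_unit_disk /= normfV invf_le1 ?normr_gt0.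
Qed.

Theorem proposition2p11 (R : realType) (X : topologicalLmodType R[i])
    (hX : @second_countable X)
    (Gamma : set {linear X -> X}) (hGamma : Gamma `<=` @continuous_operators R X)
    (hdisk : diskcyclic Gamma) :
  (forall U : nat -> set X,
      basis (range U) -> (forall n, U n !=set0) ->
      diskcyclic_vectors Gamma =
      \bigcap_n \bigcup_(T in Gamma) \bigcup_(b in @unit_disk_exterior R)
         ((T : X -> X) @^-1` [set b *: u | u in U n])) /\
  Gdelta (diskcyclic_vectors Gamma).
Proof.
split; first by move=> U; exact: diskcyclic_vectorsE.
have [U [bU U0]] := second_countable_basis_seq _ (0 : X) hX.
exists (fun n => \bigcup_(T in Gamma) \bigcup_(b in @unit_disk_exterior R)
  ((T : X -> X) @^-1` [set b *: u | u in U n])); last first.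
  exact: diskcyclic_vectorsE.
move=> n; apply: bigcup_open => T GT; apply: bigcup_open => b b1.
apply: open_comp => [x _|]; first exact: hGamma.
by apply: open_scale; [exact: unit_disk_exterior_neq0|apply: bU.1; exists n].
Qed.
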